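(* For each integer $\delta \geq 3$, there are infinitely many integers $v$ such that there exists a Kirkman triple system of order $v$ with chromatic number $\delta$.
   Context: A Steiner triple system STS$(v)$ is a pair $(V,\mathcal{B})$ with $|V|=v$ and $\mathcal{B}$ a set of $3$-subsets of $V$ such that every pair of distinct points lies in exactly one block. A Kirkman triple system KTS$(v)$ is an STS$(v)$ together with a partition of its blocks into parallel classes (sets of blocks partitioning $V$). A $\delta$-colouring is a map from the points to a set of $\delta$ colours such that no block is monochromatic; the chromatic number is the least $\delta$ for which a $\delta$-colouring exists. *)

(* Defs.v *)
From mathcomp Require Import all_boot.
Set Implicit Arguments.
Unset Strict Implicit.
Unset Printing Implicit Defensive.

Definition steiner_triple_system (V : finType) (B : {set {set V}}) : Prop :=
  (forall b, b \in B -> #|b| = 3) /\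
  (forall x y : V, x != y -> exists! b, [/\ b \in B, x \in b & y \in b]).

Definition parallel_class (V : finType) (C : {set {set V}}) : Prop :=
  partition C [set: V].

Definition kirkman_triple_system (V : finType) (B : {set {set V}})
    (P : {set {set {set V}}}) : Prop :=
  [/\ steiner_triple_system B, partition P B &
      forall C, C \in P -> parallel_class C].

Definition monochromatic (V : finType) (D : Type) (f : V -> D) (b : {set V})
    : Prop :=
  exists c, forall x, x \in b -> f x = c.

Definition colouring (V : finType) (B : {set {set V}}) (d : nat)
    (f : V -> 'I_d) : Prop :=
  forall b, b \in B -> ~ monochromatic f b.

Definition colourable (V : finType) (B : {set {set V}}) (d : nat) : Prop :=
  exists f : V -> 'I_d, colouring B f.

Definition has_chromatic_number (V : finType) (B : {set {set V}}) (d : nat)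
    : Prop :=
  colourable B d /\ (forall e, colourable B e -> d <= e).

Definition infinitely_many (Q : nat -> Prop) : Prop :=
  forall N, exists2 v, N < v & Q v.

(* Main.v *)
Require Import Defs.
From mathcomp Require Import all_boot all_algebra.

(* Let [X = AG(n, 3)] and put on [X * Z_3] the Steiner triple system whose
   blocks are the fibres [{x} * Z_3] and the triples [(x, i), (y, j), (z, k)]
   over lines [b = {x, y, z}] with [i + j + k = c b], where [c] maps lines to
   [Z_3].  It is resolvable for every [c].  For [c = 1] the second coordinate is
   a 3-colouring, whereas for [c = 0] the system is AG(n+1, 3), whose chromatic
   number tends to infinity with [n] by colour focusing.  Changing [c] on a
   single line raises the chromatic number by at most one, so on the way from
   [c = 1] to [c = 0] every value from 3 on up to that of AG(n+1, 3) occurs. *)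

Set Implicit Arguments.
Unset Strict Implicit.
Unset Printing Implicit Defensive.

Import GRing.Theory.

Local Open Scope ring_scope.

Lemma widen_ord_inj m n (le_mn : (m <= n)%N) : injective (widen_ord le_mn).
Proof. by move=> i j /(congr1 val) e; apply: val_inj. Qed.

(** * Steiner triple systems as quasigroups *)

Section SteinerQuasigroup.

Variables (V : finType) (t : V -> V -> V).

Definition block (x y : V) : {set V} := [set x; y; t x y].

Definition blocks : {set {set V}} :=
  [set block u.1 u.2 | u : V * V & u.1 != u.2].

(** Idempotent totally symmetric quasigroups: for distinct [x] and [y], [t x y] is the third point
    of their block. *)
Definition steiner_op : Prop :=
  [/\ forall x, t x x = x, forall x y, t x y = t y x
    & forall x y, t x (t x y) = y].

Lemma mem_blocks x y : x != y -> block x y \in blocks.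
Proof. by move=> xy; apply/imsetP; exists (x, y); rewrite ?inE. Qed.

Lemma blocksE b : b \in blocks -> exists x y, x != y /\ b = block x y.
Proof. by case/imsetP=> [[x y]]; rewrite inE /= => xy ->; exists x, y. Qed.

Hypothesis ts : steiner_op.

Let tid x : t x x = x. Proof. by case: ts. Qed.
Let tC x y : t x y = t y x. Proof. by case: ts. Qed.
Let tK x y : t x (t x y) = y. Proof. by case: ts. Qed.

Lemma steiner_opl_neq x y : x != y -> t x y != x.
Proof. by apply: contra => /eqP e; rewrite -(tK x y) e tid. Qed.

Lemma steiner_opr_neq x y : x != y -> t x y != y.
Proof. by rewrite eq_sym tC; apply: steiner_opl_neq. Qed.

Lemma blockC x y : block x y = block y x.
Proof. by rewrite /block (setUC [set x]) tC. Qed.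

Lemma block_third x y : block x (t x y) = block x y.
Proof. by rewrite /block tK setUAC. Qed.

Lemma block_mem x y u v : x != y -> u != v ->
  u \in block x y -> v \in block x y -> block x y = block u v.
Proof.
move=> xy uv; rewrite !inE -!orbA.
have By: block y (t x y) = block x y by rewrite (tC x y) block_third blockC.
case/or3P => /eqP ?; case/or3P => /eqP ?; subst u v; rewrite ?eqxx // in uv *.
- by rewrite block_third.
- by rewrite blockC.
- by rewrite [RHS]blockC block_third.
- by rewrite [RHS]blockC By.
Qed.

Lemma card_block x y : x != y -> #|block x y| = 3.
Proof.
move=> xy; rewrite /block setUC cardsU1 cards2 xy !inE.
by rewrite (negPf (steiner_opl_neq xy)) (negPf (steiner_opr_neq xy)).
Qed.

Lemma steiner_op_sts : steiner_triple_system blocks.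
Proof.
split=> [b /blocksE[x [y [xy ->]]]|x y xy]; first exact: card_block.
exists (block x y); split; first by rewrite mem_blocks // !inE !eqxx ?orbT.
by move=> b [/blocksE[u [v [uv ->]]] xb yb]; rewrite (@block_mem u v x y).
Qed.

Lemma colourable_steiner_op d : colourable blocks d <->
  exists f : V -> 'I_d, forall x y, x != y -> f x = f y -> f (t x y) != f x.
Proof.
split=> -[f fP]; exists f.
  move=> x y xy fxy; apply/negP => /eqP ft.
  apply: (fP _ (mem_blocks xy)); exists (f x) => z.
  by rewrite !inE -orbA => /or3P[] /eqP->.
move=> b /blocksE[x [y [xy ->]]] [c cP].
have E z : z \in block x y -> f z = c by apply: cP.
have := fP x y xy; rewrite !E ?inE ?eqxx ?orbT //.
by move/(_ erefl)/eqP.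
Qed.

Lemma colourable_blocks_leq d e : (d <= e)%N ->
  colourable blocks d -> colourable blocks e.
Proof.
move=> de /colourable_steiner_op[f fP]; apply/colourable_steiner_op.
exists (widen_ord de \o f) => x y xy /= /widen_ord_inj /(fP _ _ xy).
by apply: contraNneq => /widen_ord_inj->.
Qed.

(** Colourings form a finite type of functions, so the case split of the interpolation is available
    constructively. *)
Lemma colourable_blocks_dec d : colourable blocks d \/ ~ colourable blocks d.
Proof.
have [/existsP[f /'forall_'forall_implyP fP]|nf] := boolP
  [exists f : {ffun V -> 'I_d}, [forall x, [forall y,
     (x != y) && (f x == f y) ==> (f (t x y) != f x)]]].
  left; apply/colourable_steiner_op; exists f => x y xy fxy.
  by apply: fP; rewrite xy fxy eqxx.
right=> /colourable_steiner_op[f fP]; case/existsP: nf.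
exists [ffun x => f x]; apply/'forall_'forall_implyP => x y; rewrite !ffunE.
by case/andP=> xy /eqP; apply: fP.
Qed.

(** * Resolutions described by keys *)

Section Resolution.

(* [key x y] names the parallel class of the block through [x] and [y]. *)
Variables (K : eqType) (key : V -> V -> K).

(** The third clause makes every class cover all points; the fourth makes distinct blocks of a class
    disjoint. *)
Definition resolution_key : Prop :=
  [/\ forall x y, key x y = key y x,
      forall x y, x != y -> key x (t x y) = key x y,
      forall x y z, x != y -> exists2 w, z != w & key z w = key x y
    & forall x y z, x != y -> x != z -> key x y = key x z ->
        z = y \/ z = t x y].

Hypothesis keyP : resolution_key.

Lemma key_block x y u v : x != y -> u != v -> block u v = block x y ->
  key u v = key x y.
Proof.
case: keyP => kC kt _ _ xy uv E.
have: u \in block x y by rewrite -E !inE eqxx.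
have: v \in block x y by rewrite -E !inE eqxx orbT.
have ky : key y (t x y) = key x y by rewrite (tC x y) kt 1?eq_sym // kC.
rewrite !inE -!orbA.
case/or3P => /eqP ?; case/or3P => /eqP ?; subst u v; rewrite ?eqxx // in uv *.
- by rewrite kC kt.
- by rewrite kC.
- by rewrite kt.
Qed.

(** The pair picked is arbitrary; by [key_block] the key does not depend on it. *)
Definition block_class (b : {set V}) : option K :=
  omap (fun u => key u.1 u.2)
    [pick u : V * V | (u.1 != u.2) && (b == block u.1 u.2)].

Lemma block_classE x y : x != y -> block_class (block x y) = Some (key x y).
Proof.
move=> xy; rewrite /block_class; case: pickP => [[u v] /= /andP[uv /eqP E]|].
  by rewrite (@key_block x y u v).
by move/(_ (x, y)); rewrite /= xy eqxx.
Qed.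

Lemma resolution_key_kts :
  exists P, kirkman_triple_system blocks P.
Proof.
exists (preim_partition block_class blocks).
have pP := preim_partitionP block_class blocks.
split=> //; first exact: steiner_op_sts.
case: keyP => kC kt ksurj kinj C.
case/imsetP=> b0 /blocksE[x0 [y0 [xy0 ->]]] EC.
have CE x y : x != y -> (block x y \in C) = (key x y == key x0 y0).
  move=> xy; rewrite EC !inE mem_blocks //= !block_classE // eq_sym.
  by apply/eqP/eqP => [[]|->].
have CB b : b \in C -> exists x y, x != y /\ b = block x y.
  by rewrite EC inE => /andP[/blocksE].
rewrite /parallel_class /partition; apply/and3P; split.
- apply/eqP/setP => z; rewrite inE; apply/bigcupP.
  have [w zw kw] := ksurj x0 y0 z xy0.
  by exists (block z w); rewrite ?CE ?kw ?inE ?eqxx.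
- apply/trivIsetP => A B AC BC; apply: contraNT => /pred0Pn[z /andP[zA zB]].
  have R D : D \in C -> z \in D -> exists2 w, z != w & D = block z w.
    move=> /CB[x [y [xy ->]]] zD.
    have [xz|xz] := eqVneq x z.
      by exists y; rewrite -?xz.
    by exists x; rewrite 1?eq_sym //; apply: block_mem => //;
      rewrite 1?eq_sym // !inE eqxx.
  have [a za EA] := R A AC zA; have [b zb EB] := R B BC zB.
  move: AC BC; rewrite EA EB !CE // => /eqP<- /eqP kk.
  by case: (kinj z b a zb za kk) => ->; rewrite ?block_third.
- by apply/negP => /CB[x [y [_ /setP/(_ x)]]]; rewrite !inE eqxx.
Qed.

End Resolution.

End SteinerQuasigroup.

Lemma Z3_ind (P : 'Z_3 -> Prop) : P 0 -> P 1 -> P (-1) -> forall i, P i.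
Proof.
move=> P0 P1 P2 i.
have: [|| i == 0, i == 1 | i == -1] by case: i => [[|[|[|]]]].
by case/or3P => /eqP->.
Qed.

(** * The tripling construction *)

Section Tripling.

Variables (X : finType) (t : X -> X -> X).
Hypothesis ts : steiner_op t.

(** Inside a fibre the value 0 gives idempotence, as - i - i = i in ['Z_3], and makes the fibre a
    block, as 0 + 1 + 2 = 0. *)
Definition triple_op (c : {set X} -> 'Z_3) (p q : X * 'Z_3) : X * 'Z_3 :=
  (t p.1 q.1, (if p.1 == q.1 then 0 else c (block t p.1 q.1)) - p.2 - q.2).

Lemma triple_op_steiner c : steiner_op (triple_op c).
Proof.
have [tid tC tK] := ts; rewrite /triple_op; split=> [[x i]|[x i] [y j]|[x i] [y j]] /=.
- by rewrite tid eqxx; congr (_, _); apply/eqP; elim/Z3_ind: i.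
- by rewrite tC eq_sym blockC // addrAC.
- rewrite tK; congr (_, _).
  have [->|xy] := eqVneq x y; first by rewrite tid eqxx opprB addrCA subrr addr0.
  rewrite eq_sym (negPf (steiner_opl_neq ts xy)) block_third //.
  by rewrite opprB addrCA subrr addr0.
Qed.

(** * Resolvability of the tripled system *)

Section Key.

Variables (K : eqType) (key : X -> X -> K) (c : {set X} -> 'Z_3).
Hypothesis keyP : resolution_key t key.

(** For [p] and [q] in different fibres and [u] in the base block, this is the height above [u] of
    the block through [p] and [q]. *)
Definition fibre_value (p q : X * 'Z_3) (u : X) : 'Z_3 :=
  if u == p.1 then p.2 else if u == q.1 then q.2 else (triple_op c p q).2.

(** The choice depends on the base block alone, so all blocks above it are compared at the same two
    points. *)
Definition base_pair (b : {set X}) : option (X * X) :=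
  [pick u : X * X | [&& u.1 \in b, u.2 \in b & u.1 != u.2]].

(* The nine transversal blocks over a base block are solutions of
   [i + j + k = c]; translation by [(1, 1, 1)] splits them into three parallel
   classes, told apart by the difference of the second coordinates above two
   fixed points of the base block. *)
Definition triple_key (p q : X * 'Z_3) : option (K * 'Z_3) :=
  if p.1 == q.1 then None else
  if base_pair (block t p.1 q.1) is Some u then
    Some (key p.1 q.1, fibre_value p q u.1 - fibre_value p q u.2)
  else None.

Lemma base_pairP x y : x != y -> exists u v,
  [/\ base_pair (block t x y) = Some (u, v), u \in block t x y,
      v \in block t x y & u != v].
Proof.
move=> xy; rewrite /base_pair; case: pickP => [[u v] /and3P[]|]; first by exists u, v.
by move/(_ (x, y)); rewrite /= !inE !eqxx orbT xy.
Qed.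

Lemma fibre_valueC p q u : p.1 != q.1 -> fibre_value p q u = fibre_value q p u.
Proof.
move=> pq; rewrite /fibre_value; have [_ -> _] := triple_op_steiner c.
by have [->|//] := eqVneq u p.1; rewrite (negPf pq).
Qed.

Lemma fibre_value_third p q u : p.1 != q.1 -> u \in block t p.1 q.1 ->
  fibre_value p (triple_op c p q) u = fibre_value p q u.
Proof.
move=> pq; rewrite /fibre_value; have [_ _ ->] := triple_op_steiner c.
rewrite !inE -orbA => /or3P[] /eqP->; first by rewrite eqxx.
  by rewrite eq_sym (negPf pq) [in RHS]eqxx eq_sym (negPf (steiner_opr_neq ts pq)).
by rewrite eqxx (negPf (steiner_opl_neq ts pq)) (negPf (steiner_opr_neq ts pq)).
Qed.

(** The three heights sum to a constant, so the difference is affine in [j] with slope 1, -1, 2 or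
    -2, a unit modulo 3. *)
Lemma fibre_value_inj x y i u v : x != y ->
  u \in block t x y -> v \in block t x y -> u != v ->
  injective (fun j => fibre_value (x, i) (y, j) u - fibre_value (x, i) (y, j) v).
Proof.
move=> xy; rewrite /fibre_value /= (negPf xy).
have nyx : (y == x) = false by rewrite eq_sym (negPf xy).
have ntx := negPf (steiner_opl_neq ts xy); have nty := negPf (steiner_opr_neq ts xy).
move: (c _) => d.
rewrite !inE -!orbA => /or3P[] /eqP-> /or3P[] /eqP->; rewrite ?eqxx // => _ j k;
  rewrite ?eqxx ?nyx ?ntx ?nty ?eqxx.
- by move/addrI/oppr_inj.
- by move/addrI/oppr_inj/addrI/oppr_inj.
- by move/addIr.
- by move/eqP=> e; apply/eqP; move: e; elim/Z3_ind: i; elim/Z3_ind: j; elim/Z3_ind: k; elim/Z3_ind: d.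
- by move/addIr/addrI/oppr_inj.
- by move/eqP=> e; apply/eqP; move: e; elim/Z3_ind: i; elim/Z3_ind: j; elim/Z3_ind: k; elim/Z3_ind: d.
Qed.

Lemma triple_key_resolution : resolution_key (triple_op c) triple_key.
Proof.
have [tid tC tK] := ts; have [kC kt ksurj kinj] := keyP.
have tsK := triple_op_steiner c.
have key3 p q : p != q -> triple_key p (triple_op c p q) = triple_key p q.
  move=> pq; rewrite /triple_key /=.
  have [e|ne] := eqVneq p.1 q.1; first by rewrite -e tid eqxx.
  rewrite eq_sym (negPf (steiner_opl_neq ts ne)) block_third // kt //.
  by have [u [v [-> /= ub vb _]]] := base_pairP ne; rewrite !fibre_value_third.
split=> //.
- move=> p q; rewrite /triple_key eq_sym; case: eqVneq => // pq.
  rewrite eq_sym in pq.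
  by rewrite kC blockC //; case: base_pair => // u; rewrite !(@fibre_valueC q p) // eq_sym.
- move=> [x i] [y j] [z k] _; rewrite {2}/triple_key /=.
  case: eqVneq => [_|xy].
    exists (z, k + 1); last by rewrite /triple_key eqxx.
    by rewrite xpair_eqE eqxx /=; elim/Z3_ind: k.
  have [u [v [-> _ _ _]]] := base_pairP xy.
  have [w zw kw] := ksurj x y z xy.
  have [u' [v' [E ub vb uv]]] := base_pairP zw.
  (* An injective self-map of ['Z_3] is onto, so some height [l] above [w] gives the required
     difference. *)
  have /codomP[l ->] := injF_onto (@fibre_value_inj z w k u' v' zw ub vb uv)
    (fibre_value (x, i) (y, j) u - fibre_value (x, i) (y, j) v).
  exists (w, l); first by rewrite xpair_eqE (negPf zw).
  by rewrite /triple_key /= (negPf zw) E kw.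
- move=> p q r pq pr.
  have same s : p != s -> s.1 = q.1 -> triple_key p q = triple_key p s ->
      s = q \/ s = triple_op c p q.
    case: p q s pq {pr} => x i [y j] [z k] /= pq ps ez; subst z.
    rewrite /triple_key /=.
    have [exy|ne] := eqVneq x y.
      subst y; move=> _; apply/pred2P; move: pq ps.
      rewrite /triple_op /= tid !xpair_eqE !eqxx /=.
      by elim/Z3_ind: i; elim/Z3_ind: j; elim/Z3_ind: k.
    have [u [v [-> ub vb uv]]] := base_pairP ne.
    by move=> /Some_inj/(congr1 snd)/(fibre_value_inj ne ub vb uv) ->; left.
  move=> kqr; have [/eqP e|ne] := boolP (r.1 == q.1); first exact: same.
  (* Otherwise [r] lies above the third base point, and the third point of its block with [p] lies
     in the fibre of [q], where [same] applies. *)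
  have er : (triple_op c p r).1 = q.1.
    move: kqr; rewrite /triple_key.
    have [epq|npq] := eqVneq p.1 q.1.
      have [epr|npr] := eqVneq p.1 r.1; first by rewrite -epr epq eqxx in ne.
      by have [? [? [-> _ _ _]]] := base_pairP npr.
    have [? [? [-> _ _ _]]] := base_pairP npq.
    have [//|npr] := eqVneq p.1 r.1.
    have [? [? [-> _ _ _]]] := base_pairP npr => -[kk _].
    by case: (kinj _ _ _ npq npr kk) ne => [->|/= ->]; rewrite ?eqxx ?tK.
  have rpr : p != triple_op c p r by rewrite eq_sym (steiner_opl_neq tsK).
  have [_ _ tKK] := tsK.
  have := same _ rpr er; rewrite key3 // => /(_ kqr).
  case=> [<-|E]; first by rewrite tKK; right.
  by left; rewrite -[LHS](tKK p) E tKK.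
Qed.

End Key.

Lemma triple_kts (K : eqType) (key : X -> X -> K) c : resolution_key t key ->
  exists P, kirkman_triple_system (blocks (triple_op c)) P.
Proof.
move=> /(triple_key_resolution c); apply: resolution_key_kts.
exact: triple_op_steiner.
Qed.

(** * Colourings of the tripled system *)

Lemma triple_colourable3 d : (3 <= d)%N ->
  colourable (blocks (triple_op (fun=> 1))) d.
Proof.
move=> d3; apply/colourable_steiner_op.
exists (fun p : X * 'Z_3 => widen_ord d3 p.2) => -[x i] [y j] /= pq.
move=> /widen_ord_inj eij; subst j.
have xy : x != y by apply: contraNneq pq => ->.
(* A monochromatic transversal block would give 3 i = 1 in ['Z_3]. *)
rewrite (negPf xy) -val_eqE /=.
by elim/Z3_ind: i {pq}.
Qed.

(** The points of height 0 form a copy of the base system, and the colouring restricts to it. *)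
Lemma triple_colourable_subsystem c d :
  (forall x y, x != y -> c (block t x y) = 0) ->
  colourable (blocks (triple_op c)) d -> colourable (blocks t) d.
Proof.
move=> c0 /colourable_steiner_op[f fP]; apply/colourable_steiner_op.
exists (fun x => f (x, 0)) => x y xy fxy.
have := fP (x, 0) (y, 0); rewrite xpair_eqE (negPf xy) => /(_ isT fxy).
by rewrite /triple_op /= c0 // if_same !subr0.
Qed.

(* Only the nine transversal blocks over the block through [x] and [y] change.
   At most one of the new ones through [(x, -1)] is monochromatic, so the
   monochromatic ones are all hit by [(x, 0)], [(x, 1)] and one point [(y, j)];
   these three points do not form a block and may receive a new colour. *)
Lemma triple_colourableS c c' x y d : x != y ->
  (forall b, b != block t x y -> c b = c' b) ->
  colourable (blocks (triple_op c)) d -> colourable (blocks (triple_op c')) d.+1.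
Proof.
move=> xy cc' /colourable_steiner_op[f fP]; apply/colourable_steiner_op.
have tsK := triple_op_steiner c'; have [tid _ _] := ts; have [_ tCK _] := tsK.
pose mono j := (f (y, j) == f (x, -1)) &&
  (f (triple_op c' (x, -1) (y, j)) == f (x, -1)).
(* If no [j] satisfies [mono], any point above [y] serves. *)
pose j0 := odflt 0 [pick j | mono j].
pose S := [set (x, 0); (x, 1); (y, j0)].
have S_free p q : p != q -> p \in S -> q \in S -> triple_op c' p q \notin S.
  have nyx : (y == x) = false by rewrite eq_sym (negPf xy).
  have ntx := negPf (steiner_opl_neq ts xy).
  have nty := negPf (steiner_opr_neq ts xy).
  have key01 : triple_op c' (x, 0) (x, 1) \notin S.
    by rewrite /triple_op /= tid eqxx !inE !xpair_eqE (negPf xy) /= andbC.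
  have keyxy i : triple_op c' (x, i) (y, j0) \notin S.
    by rewrite /triple_op /= !inE !xpair_eqE ntx nty.
  have inS r : r \in S -> [\/ r = (x, 0), r = (x, 1) | r = (y, j0)].
    by rewrite !inE -orbA => /or3P[] /eqP->; [apply: Or31 | apply: Or32 | apply: Or33].
  move=> pq /inS pS /inS qS; case: pS qS => ? [] ?; subst p q;
    rewrite ?eqxx // in pq *; by rewrite tCK.
exists (fun p => if p \in S then ord_max else widen_ord (leqnSn d) (f p)).
have new p : widen_ord (leqnSn d) (f p) != ord_max.
  by rewrite -val_eqE /= neq_ltn ltn_ord.
move=> p q pq; case: ifP => pS; case: ifP => qS.
- by move=> _; rewrite (negPf (S_free p q pq pS qS)).
- by move/eqP; rewrite eq_sym (negPf (new _)).
- by move/eqP; rewrite (negPf (new _)).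
move/widen_ord_inj => fpq.
case: ifP => rS; first by rewrite eq_sym.
apply/negP => /eqP/widen_ord_inj frp.
have same : triple_op c p q != triple_op c' p q.
  by apply/eqP => e; have := fP p q pq fpq; rewrite e frp eqxx.
have npq : p.1 != q.1.
  by apply: contraNneq same => e; rewrite /triple_op e eqxx.
have cpq : c (block t p.1 q.1) != c' (block t p.1 q.1).
  by apply: contraNneq same => e; rewrite /triple_op e.
have bxy : block t p.1 q.1 = block t x y.
  by apply/eqP; apply: contraNT cpq => /cc'->.
rewrite bxy in cpq.
have over u : u \in block t x y ->
    exists i, [/\ (u, i) \in block (triple_op c') p q, (u, i) \notin S
                & f (u, i) = f p].
  rewrite -bxy !inE -orbA => /or3P[] /eqP->.
  - by exists p.2; rewrite -surjective_pairing pS /block in_setU in_set2 eqxx.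
  - by exists q.2; rewrite -surjective_pairing qS /block in_setU in_set2 eqxx orbT fpq.
  - exists (triple_op c' p q).2; rewrite -[(t _ _, _)]/(triple_op c' p q).
    by rewrite rS /block in_setU in_set1 eqxx orbT frp.
have [|i [xb xS fx]] := over x; first by rewrite !inE eqxx.
have [|j [yb yS fy]] := over y; first by rewrite !inE eqxx orbT.
have nxy : (x, i) != (y, j) by rewrite xpair_eqE (negPf xy).
have fz : f (triple_op c' (x, i) (y, j)) = f p.
  have : triple_op c' (x, i) (y, j) \in block (triple_op c') p q.
    by rewrite (block_mem tsK pq nxy xb yb) !inE eqxx orbT.
  by rewrite !inE -orbA => /or3P[] /eqP->.
have ei : i = -1 by apply/eqP; move: xS; rewrite !inE !xpair_eqE eqxx; elim/Z3_ind: (i).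
subst i.
have nj : j != j0 by move: yS; rewrite !inE !xpair_eqE !eqxx /=; rewrite !negb_or => /andP[].
have mj : mono j by rewrite /mono fy fz fx eqxx.
have /andP[/eqP f0 /eqP f0z] : mono j0.
  by rewrite /j0; case: pickP => // /(_ j); rewrite mj.
have cP k : f (y, k) = f p -> f (t x y, c (block t x y) + 1 - k) != f p.
  move=> fk; have := fP (x, -1) (y, k).
  rewrite xpair_eqE (negPf xy) /triple_op /= (negPf xy) opprK fx => /(_ isT).
  by rewrite fk; apply.
have := cP _ fy; have := cP j0; rewrite f0 fx => /(_ erefl).
move: f0z fz; rewrite /triple_op /= (negPf xy) opprK fx.
move: (c _) (c' _) cpq (j0) nj => a b ab k jk.
(* Both a - b and j - k are nonzero in ['Z_3], hence equal up to sign. So the new third point for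
   one of the two heights is the old third point for the other: it has the colour of [p], which [cP]
   forbids. *)
have e : (a + 1 - j == b + 1 - k) || (a + 1 - k == b + 1 - j).
  move: (j) ab jk => l.
  by elim/Z3_ind: a; elim/Z3_ind: b; elim/Z3_ind: l; elim/Z3_ind: k.
by case/orP: e => /eqP-> f1 f2; rewrite ?f1 ?f2 eqxx // => _; rewrite eqxx.
Qed.

End Tripling.

(** * Affine space over ['Z_3] *)

Section AffineSpace.

Variable n : nat.
Implicit Types x y z : 'rV['Z_3]_n.

(** Three distinct points are collinear exactly when their sum is 0. *)
Definition affine_op x y := - (x + y).

(** The direction of the line, as a difference up to sign; a class consists of parallel lines. *)
Definition affine_key x y := [set x - y; y - x].

Lemma row_Z3_double x : x + x = - x.
Proof. by apply/rowP => i; rewrite !mxE; apply/eqP; elim/Z3_ind: (x 0 i). Qed.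

Lemma affine_op_steiner : steiner_op affine_op.
Proof.
rewrite /affine_op; split=> [x|x y|x y]; first by rewrite row_Z3_double opprK.
  by rewrite addrC.
by rewrite opprB addrC addKr.
Qed.

Lemma affine_key_resolution : resolution_key affine_op affine_key.
Proof.
rewrite /affine_op /affine_key; split=> [x y|x y _|x y z xy|x y z xy xz].
- exact: setUC.
- have e : x - - (x + y) = y - x by rewrite opprK addrA row_Z3_double addrC.
  by rewrite -[- (x + y) - x]opprB e opprB setUC.
- exists (z - (x - y)); last by rewrite subKr addrAC subrr sub0r opprB.
  by rewrite -subr_eq0 subKr subr_eq0.
- move/setP/(_ (x - z)); rewrite !inE eqxx /= => /orP[]/eqP.
    by move/addrI/oppr_inj; left.
  move=> e; right; rewrite -[LHS](subKr x) e opprB addrA row_Z3_double.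
  by rewrite opprD.
Qed.

End AffineSpace.

(** * Monochromatic lines by colour focusing *)

Lemma affine_op_row_mx m n (a b : 'rV_m) (x y : 'rV_n) :
  affine_op (row_mx a x) (row_mx b y) = row_mx (affine_op a b) (affine_op x y).
Proof. by rewrite /affine_op add_row_mx opp_row_mx. Qed.

Definition mono_line n (C : Type) (f : 'rV['Z_3]_n -> C) : Prop :=
  exists x y, [/\ x != y, f x = f y & f (affine_op x y) = f x].

Lemma mono_line_row_mx m n C (a : 'rV_m) (f : 'rV_(m + n) -> C) :
  mono_line (fun x => f (row_mx a x)) -> mono_line f.
Proof.
case=> x [y [xy fxy ft]]; exists (row_mx a x), (row_mx a y).
rewrite affine_op_row_mx; have [-> _ _] := affine_op_steiner m; split=> //.
by apply: contraNneq xy => /eq_row_mx[_ ->].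
Qed.

(* Colour focusing, as for van der Waerden's theorem: if the fibres over [a] and
   [b] are coloured alike, the pairs focused at [z] in that fibre and the pair
   [(a, z)], [(b, z)] are all focused at the point [z] of the third fibre. *)
Lemma colour_focusing (C : finType) m : exists n, forall f : 'rV['Z_3]_n -> C,
  mono_line f \/ exists z (S : {set C}), #|S| = m /\
    forall c, c \in S -> exists x y, [/\ x != y, affine_op x y = z, f x = c & f y = c].
Proof.
elim: m => [|m [n IH]].
  by exists 0%N => f; right; exists 0, set0; rewrite cards0; split=> // c; rewrite inE.
pose k := #|{: {ffun 'rV['Z_3]_n -> C}}|.
exists (k + n)%N => f.
pose F (a : 'rV['Z_3]_k) := [ffun x : 'rV['Z_3]_n => f (row_mx a x)].
(* Pigeonhole: there are 3^k > k fibres and only [k] colourings of a fibre. *)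
have /injectivePn[a [b ab Fab]] : ~~ injectiveb F.
  apply/injectiveP => /leq_card; rewrite leqNgt card_mx card_ord mul1n.
  by rewrite ltn_expl.
have fab x : f (row_mx a x) = f (row_mx b x).
  by have /ffunP/(_ x) := Fab; rewrite !ffunE.
have [/mono_line_row_mx|[z [S [cS foc]]]] := IH (fun x => f (row_mx a x)); first by left.
(* If [z] has a focused colour, it completes a pair of that colour to a monochromatic line. *)
have [zS|zS] := boolP (f (row_mx a z) \in S).
  left; apply: (@mono_line_row_mx _ _ _ a).
  by have [x [y [xy e fx fy]]] := foc _ zS; exists x, y; rewrite e fx fy.
right; exists (row_mx (affine_op a b) z), (f (row_mx a z) |: S).
rewrite cardsU1 zS cS; split=> // c; rewrite !inE => /orP[/eqP->|/foc].
  exists (row_mx a z), (row_mx b z); rewrite affine_op_row_mx -fab.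
  have [-> _ _] := affine_op_steiner n; split=> //.
  by apply: contraNneq ab => /eq_row_mx[->].
case=> x [y [xy e fx fy]]; exists (row_mx a x), (row_mx b y).
rewrite affine_op_row_mx e -fab; split=> //.
by apply: contraNneq xy => /eq_row_mx[_ ->].
Qed.

(** Among [d] colours no d + 1 can be focused, so a monochromatic line is forced. Fixing [N] further
    coordinates at 0 makes the dimension large. *)
Lemma affine_not_colourable d N : exists2 n, (N <= n)%N &
  ~ colourable (blocks (@affine_op n)) d.
Proof.
have [n nP] := colour_focusing 'I_d d.+1.
exists (N + n)%N; first exact: leq_addr.
move/colourable_steiner_op => -[f fP].
suff [x [y [xy fxy /eqP]]] : mono_line f by apply/negP; apply: fP.
apply: (@mono_line_row_mx _ _ _ 0).
have [//|[z [S [cS _]]]] := nP (fun x => f (row_mx 0 x)).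
by have := max_card (mem S); rewrite cS card_ord ltnn.
Qed.

(** * Interpolation of the chromatic number *)

Lemma triple_chromatic_interpolation (X : finType) (t : X -> X -> X) d :
  steiner_op t -> (3 <= d)%N -> ~ colourable (blocks t) d.-1 ->
  exists c, has_chromatic_number (blocks (triple_op t c)) d.
Proof.
move=> ts d3 nt.
pose cs (s : seq (X * X)) b : 'Z_3 :=
  if b \in [seq block t u.1 u.2 | u <- s] then 0 else 1.
suff main s : all (fun u => u.1 != u.2) s ->
    ~ colourable (blocks (triple_op t (cs s))) d.-1 ->
    exists c, has_chromatic_number (blocks (triple_op t c)) d.
  (* With every pair listed, [cs] vanishes on all blocks, and a (d - 1)-colouring would restrict to
     the base system. *)
  apply: (main [seq u <- enum {: X * X} | u.1 != u.2]); first exact: filter_all.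
  apply: contra_not nt; apply: triple_colourable_subsystem => x y xy.
  by rewrite /cs ifT //; apply/mapP; exists (x, y); rewrite // mem_filter xy mem_enum.
have chi c : colourable (blocks (triple_op t c)) d ->
    ~ colourable (blocks (triple_op t c)) d.-1 ->
    has_chromatic_number (blocks (triple_op t c)) d.
  move=> cd ncd; split=> // e ce; rewrite leqNgt; apply/negP => ed; apply: ncd.
  by apply: colourable_blocks_leq ce; rewrite -ltnS prednK // (leq_trans _ d3).
elim: s => [|[x y] s IH] /= => [_ n0|/andP[xy sP] ns].
  exists (cs [::]); apply: chi n0.
  exact: triple_colourable3.
(* If d - 1 colours suffice before the block of [x] and [y] is switched and not after, then [d]
   suffice after. *)
have [cd|] := colourable_blocks_dec (triple_op t (cs s)) d.-1; last exact: IH.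
exists (cs ((x, y) :: s)); apply: chi ns.
rewrite -(prednK (leq_trans _ d3)) //; apply: (triple_colourableS ts xy _ cd) => b nb.
by rewrite /cs inE (negPf nb).
Qed.

Local Close Scope ring_scope.

Theorem theorem1p3 (delta : nat) (hdelta : 3 <= delta) :
  infinitely_many (fun v : nat =>
    exists (V : finType) (B : {set {set V}}) (P : {set {set {set V}}}),
      [/\ #|V| = v, kirkman_triple_system B P & has_chromatic_number B delta]).
Proof.
move=> N; have [n Nn nc] := affine_not_colourable delta.-1 N.
have tn := affine_op_steiner n.
have [c cP] := triple_chromatic_interpolation tn hdelta nc.
have [P PP] := triple_kts tn c (affine_key_resolution n).
exists #|{: 'rV['Z_3]_n * 'Z_3}|; last by do 3!eexists; split; [|exact: PP|exact: cP].
(* The order is 3^n * 3, which exceeds [n] and hence [N]. *)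
rewrite card_prod card_mx card_ord mul1n.
by apply: leq_ltn_trans Nn (leq_trans (@ltn_expl 3 n _) _); rewrite ?leq_pmulr.
Qed.
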